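(* Let $R$ be a finite group. The base size of the action of $\mathrm{Aut}(R)$ on $\mathrm{Sub}(R)$ is $1$ if and only if $R$ is cyclic.
   Context: $\mathrm{Aut}(R)$ is the automorphism group of $R$ and $\mathrm{Sub}(R)$ is the set of all subgroups of $R$. $\mathrm{Aut}(R)$ acts on $\mathrm{Sub}(R)$ by sending $H\in\mathrm{Sub}(R)$ to its image $H^\alpha$ under $\alpha\in\mathrm{Aut}(R)$. Let $\mathrm{A}(R)$ denote the permutation group on $\mathrm{Sub}(R)$ induced by this action. An automorphism $\alpha$ of $R$ is a power automorphism if for every $x\in R$ there exists $n_x\in\mathbb{Z}$ with $x^\alpha=x^{n_x}$; the power automorphisms form a subgroup $\mathrm{PAut}(R)$ of $\mathrm{Aut}(R)$, which is exactly the kernel of the action on $\mathrm{Sub}(R)$, so $\mathrm{A}(R)\cong\mathrm{Aut}(R)/\mathrm{PAut}(R)$. A base for a permutation group $G$ is a (nonempty) sequence $\omega_1,\ldots,\omega_\ell$ ($\ell\ge 1$) of elements of the domain of $G$ whose pointwise stabilizer in $G$ is the identity. The base size of $G$ is the minimal cardinality of a base. The base size of the action of $\mathrm{Aut}(R)$ on $\mathrm{Sub}(R)$ means the base size of the permutation group $\mathrm{A}(R)$. Thus this base size is $1$ if and only if there exists a subgroup $H\le R$ such that $\{\alpha\in\mathrm{Aut}(R): H^\alpha=H\}=\mathrm{PAut}(R)$. In particular, when $\mathrm{A}(R)$ is trivial its base size is taken to be $1$. *)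

(* Defs.v *)
From HB Require Import structures.
From mathcomp Require Import all_boot all_fingroup all_solvable.

Set Implicit Arguments.
Unset Strict Implicit.
Unset Printing Implicit Defensive.

Import GroupScope.

Section Base.

Variable T : finType.
Implicit Type G : {group {perm T}}.

Definition is_base G (s : seq T) : bool :=
  (s != [::]) && ('C_G([set:: s] | 'P) == 1).

Definition has_base_of_size G (l : nat) : bool :=
  [exists s : l.-tuple T, is_base G s].

Lemma has_base_exists (x0 : T) G : exists l, has_base_of_size G l.
Proof.
exists #|T|; apply/existsP; exists (enum_tuple T).
rewrite /is_base /= -size_eq0 -cardE -lt0n (introT card_gt0P _) /=; last by exists x0.
rewrite -subG1; apply/subsetP=> g /setIP[_ /astabP fixg]; apply/set1P/permP=> x.
by rewrite perm1 -[RHS](fixg x) // inE mem_enum.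
Qed.

(* A permutation group on an empty domain has no (nonempty) base, so the
   domain is required to contain a point; the value does not depend on it. *)
Definition base_size (x0 : T) G : nat := ex_minn (has_base_exists x0 G).

End Base.

Section SubgroupAction.

Variables (gT : finGroupType) (R : {group gT}).

Definition is_subgroup : pred {set gT} :=
  fun H => group_set H && (H \subset R).

Definition subgroup_of : Type := {H : {set gT} | is_subgroup H}.

HB.instance Definition _ := SubFinite.on subgroup_of.

Lemma is_subgroup1 : is_subgroup 1.
Proof. by rewrite /is_subgroup group_set_one sub1G. Qed.

Definition trivial_subgroup : subgroup_of := exist _ 1 is_subgroup1.

(* 'P^* sends H to its image under a permutation of gT; 'P^*^? is its
   restriction to the subgroups of R. *)
Definition subgroup_action : action _ subgroup_of := ('P^*)^?.

(* MathComp morphisms silently restrict to their domain; this shows that no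
   automorphism is lost in the definition of A_group. *)
Lemma Aut_subact_dom : Aut R \subset subact_dom is_subgroup 'P^*.
Proof.
apply/subsetP=> a Aa; rewrite !inE /=; apply/subsetP=> H /[!inE] /andP[gH sHR].
have eqHa: 'P^*%act H a = autm Aa @* H.
  by rewrite morphimEsub.
rewrite eqHa /is_subgroup -[X in _ @* X]/(gval (Group gH)) groupP /=.
by apply: subset_trans (morphimS _ sHR) _; rewrite im_autm.
Qed.

(* The permutation group A(R) on Sub(R). *)
Definition A_group : {group {perm subgroup_of}} := (actperm subgroup_action @* Aut R)%G.

End SubgroupAction.

(* Main.v *)
Require Import Defs.
From mathcomp Require Import all_boot all_fingroup all_solvable.

Set Implicit Arguments.
Unset Strict Implicit.
Unset Printing Implicit Defensive.

Import GroupScope.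

(** Base size 1 means that some subgroup H is rigid: every automorphism of R
    that maps H to itself fixes every subgroup of R.  If R is cyclic, all its
    subgroups are characteristic, so any H will do.  Conversely a rigid H makes
    R cyclic, for the following reasons.

    Conjugation by an element of N = 'N_R(H) fixes H, so N normalises every
    subgroup of R; conversely an element normalising every subgroup lies in N,
    so N is normal in R.  For c in N and x in R the commutator [~ x, c] lies in
    both <[x]> and <[x * c]> ([comm_power_memM]), so it commutes with x and
    with c.  Hence elements of N commute with elements of R of coprime order,
    and since 'C_R(N) is contained in N, R is nilpotent ([rigid_nilpotent]).
    Rigidity passes to the Sylow subgroups, so R may be assumed to be a p-group,
    and H may be assumed proper, because H = R and H = 1 have the same
    stabiliser.

    The automorphisms that contradict rigidity are all of one shape: if B is
    normal of index p, a is outside B, t is in 'Z(B) and (a * t)^p = a^p, then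
    B can be fixed pointwise while a is sent to a * t
    ([transvection_morphism]).  If H is in B, rigidity forces t to be a power
    of a.  With B a maximal subgroup M containing H and t central, this shows
    that every x outside M has the same subgroup of order p, generated by a
    central element z; thus <[z]> is the socle of 'Z(R), and elements c of N
    with c^p central satisfy [~ g, c] in <[z]> for all g in R, so that a
    noncentral such c has centraliser of index p.  With B this centraliser,
    the transvections show that all elements of order p in N are central
    ([norm_roots_central]); when p = 2 this takes an element u of N with
    u^2 = z.  So N has a unique subgroup of order p and is cyclic or generalised
    quaternion.  If N is cyclic, H is characteristic in the normal subgroup N,
    so N = R.  If N is quaternion, the commutator property above gives exponent
    4, then N = R again, and a last transvection excludes this case. *)

(** * Automorphisms fixing a subgroup of prime index *)

Section Transvection.

Variables (gT : finGroupType) (R B : {group gT}) (p : nat) (a t : gT).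
Hypotheses (nBR : B <| R) (iB : #|R : B| = p) (p_pr : prime p).
Hypotheses (Ra : a \in R) (nBa : a \notin B) (Zt : t \in 'Z(B)).
Hypothesis atp : (a * t) ^+ p = a ^+ p.

(* An element b * a ^+ i, with b in B, is to be sent to b * (a * t) ^+ i, that
   is, multiplied on the right by g i. *)
Let g i := a ^- i * (a * t) ^+ i.
Let k x := if [pick i : 'I_p | x * a ^- i \in B] is Some i then val i else 0.
Let s x := x * g (k x).

Let nB x : x \in R -> x \in 'N(B).
Proof. exact: subsetP (normal_norm nBR) x. Qed.

Let order_a : #[coset B a] = p.
Proof.
have: #[coset B a] %| p.
  by rewrite -iB -card_quotient ?normal_norm // order_dvdG ?mem_quotient.
case/(proj2 (primeP p_pr))/orP=> [|/eqP//].
rewrite order_eq1 => /eqP /coset_idr; rewrite nB // => /(_ isT) Ba.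
by case/negP: nBa.
Qed.

Let in_coset x i :
  x \in R -> (x * a ^- i \in B) = (coset B x == coset B a ^+ i).
Proof.
move=> Rx; rewrite -mem_rcoset -morphX ?nB //.
by apply: (sameP (rcoset_kercosetP _ _) eqP); rewrite ?groupX ?nB.
Qed.

Let kP x : x \in R -> x * a ^- k x \in B.
Proof.
move=> Rx; rewrite /k; case: pickP => //= no.
have /cycleP[i def_i] : coset B x \in <[coset B a]>.
  have/eqP->: <[coset B a]> == R / B; last exact: mem_quotient.
  rewrite eqEcard cycle_subG mem_quotient //= -orderE order_a.
  by rewrite card_quotient ?normal_norm // iB.
have := no (Ordinal (ltn_pmod i (prime_gt0 p_pr))).
by rewrite in_coset //= -order_a expg_mod_order -def_i eqxx.
Qed.

Let g_mod i : g (i %% p) = g i.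
Proof.
rewrite /g [in RHS](divn_eq i p) !expgD mulnC !expgM atp.
by rewrite invMg mulgA mulgKV.
Qed.

Let sE x i : x \in R -> x * a ^- i \in B -> s x = x * g i.
Proof.
move=> Rx xi; rewrite /s -g_mod -[g i]g_mod; congr (_ * g _); apply/eqP.
rewrite -order_a -eq_expg_mod_order.
have := kP Rx; rewrite in_coset // => /eqP <-.
by rewrite -in_coset.
Qed.

Let Zg i : g i \in 'Z(B).
Proof.
elim: i => [|i IHi]; first by rewrite /g !expg0 mulg1 invg1 group1.
have ->: g i.+1 = g i ^ a * t.
  by rewrite /g conjgE expgSr [(a * t) ^+ _]expgSr invMg !mulgA.
rewrite groupM // memJ_norm //.
by rewrite (subsetP (normal_norm (char_normal_trans (center_char B) nBR))).
Qed.

Let gR i : g i \in R.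
Proof. by rewrite (subsetP (normal_sub nBR)) // (subsetP (center_sub B)). Qed.

Let sM : {in R &, {morph s : x y / x * y}}.
Proof.
move=> x y Rx Ry; have [xi yj] := (kP Rx, kP Ry).
move: (k x) (k y) xi yj => i j xi yj.
have nai : a ^- i \in 'N(B) by rewrite groupV groupX ?nB.
have xyij : x * y * a ^- (i + j) = (x * a ^- i) * (y * a ^- j) ^ a ^- i.
  by rewrite conjgE invgK expgD invMg !mulgA mulgKV.
rewrite (sE (i := i + j) (groupM Rx Ry)); last first.
  by rewrite xyij groupM ?memJ_norm.
rewrite (sE Rx xi) (sE Ry yj) !mulgA -!(mulgA x); congr (_ * _).
rewrite -{2}[y](mulgKV (a ^+ j)) !mulgA -(mulgA (g i)).
have /centerP[_ cgi] := Zg i.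
by rewrite mulgK (cgi _ yj) /g !expgD invMg !mulgA.
Qed.

Let fs := Morphism sM.

(** R is generated by B and a, subject to the relations giving the action of a
    on B and the value of a ^+ p in B; a * t satisfies the same relations since
    t centralises B. *)
Lemma transvection_morphism :
  exists f : {morphism R >-> gT},
    [/\ 'injm f, f @* R = R, {in B, f =1 id} & f a = a * t].
Proof.
have sBR := normal_sub nBR.
have fB : {in B, s =1 id}.
  move=> x Bx; rewrite (sE (i := 0)) ?(subsetP sBR) //; last first.
    by rewrite expg0 invg1 mulg1.
  by rewrite /g !expg0 invg1 !mulg1.
have injf : 'injm fs.
  apply/subsetP=> x /morphpreP[Rx /set1P /= sx1]; apply/set1P.
  have Bx : x \in B.
    have: s x \in B by rewrite sx1.
    by rewrite /s groupMr // (subsetP (center_sub B)).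
  by rewrite -(fB x Bx).
exists fs; split=> //.
  apply/eqP; rewrite eqEcard card_injm // leqnn andbT.
  by apply/subsetP=> _ /morphimP[x _ Rx ->]; rewrite /= /s groupM.
rewrite /= (sE (i := 1)) ?expg1 ?mulgV // /g !expg1.
by rewrite mulKVg.
Qed.

End Transvection.

(** * Elements normalising every subgroup *)

Section PowerConj.

Variables (gT : finGroupType) (R : {group gT}) (c x : gT).
Hypotheses (Rc : c \in R) (Rx : x \in R).
Hypothesis powc : {in R, forall y, y ^ c \in <[y]>}.

Lemma comm_power_mem : [~ x, c] \in <[x]>.
Proof. by rewrite /commg groupMl ?powc // groupV cycle_id. Qed.

Let cx : commute x [~ x, c].
Proof. by case/cycleP: comm_power_mem => i ->; apply: commuteX. Qed.

(** As x commutes with [~ x, c], the latter also equals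
    (x * c) ^ c * (x * c)^-1, and c normalises <[x * c]>. *)
Lemma comm_power_memM : [~ x, c] \in <[x * c]>.
Proof.
have ->: [~ x, c] = (x * c) ^ c * (x * c)^-1.
  rewrite conjMg (_ : c ^ c = c); last by rewrite conjgE mulKg.
  have xc : x ^ c = x * [~ x, c] by rewrite mulKVg.
  by rewrite xc cx invMg !mulgA !mulgK.
by rewrite groupM ?powc ?groupM // groupV cycle_id.
Qed.

Lemma comm_power_commute : commute x [~ x, c] /\ commute c [~ x, c].
Proof.
have cxc : commute (x * c) [~ x, c].
  by case/cycleP: comm_power_memM => i ->; apply: commuteX.
split=> //; apply: commute_sym.
have: commute [~ x, c] (x^-1 * (x * c)) by apply: commuteM; [apply: commuteV|].
by rewrite mulKg.
Qed.

End PowerConj.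

(** * Subgroups whose stabiliser consists of power automorphisms *)

(** Automorphisms of R are given here as injective morphisms onto R, so that
    the property can be used for subgroups of R as well. *)
Definition rigid (gT : finGroupType) (R H : {group gT}) :=
  forall f : {morphism R >-> gT}, 'injm f -> f @* R = R -> f @* H = H ->
  {in R, forall x, f x \in <[x]>}.

Section Rigid.

Variables (gT : finGroupType) (R H : {group gT}).
Hypotheses (rigH : rigid R H) (sHR : H \subset R).

Local Notation N := 'N_R(H).

Lemma rigid_norm_power c : c \in N -> {in R, forall x, x ^ c \in <[x]>}.
Proof.
case/setIP=> Rc nHc x Rx.
have -> : x ^ c = conjgm R c x by [].
apply: rigH => //; first exact: injm_conj.
  by rewrite morphim_conj setIid conjGid.
by rewrite morphim_conj (setIidPr sHR) (normP nHc).
Qed.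

Lemma power_mem_norm c :
  c \in R -> {in R, forall x, x ^ c \in <[x]>} -> c \in N.
Proof.
move=> Rc powc; rewrite inE Rc inE; apply/subsetP=> _ /imsetP[h Hh ->].
have := powc h (subsetP sHR h Hh).
by apply/subsetP; rewrite cycle_subG.
Qed.

(** By the two previous lemmas N is the norm of R, the set of elements that
    normalise every cyclic subgroup, whatever H is. *)
Lemma rigid_norm_normal : N <| R.
Proof.
rewrite /normal subsetIl; apply/subsetP=> g Rg; rewrite inE.
apply/subsetP=> _ /imsetP[c Nc ->]; have Rc : c \in R by case/setIP: Nc.
apply: power_mem_norm; first exact: groupJ.
move=> x Rx; rewrite -{1}(conjgKV g x) -conjJg.
have := rigid_norm_power Nc (groupJ Rx (groupVr Rg)).
by rewrite -(memJ_conjg _ g) -cycleJ conjgKV.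
Qed.

Lemma rigid_comm c x : c \in N -> x \in R ->
  [/\ [~ x, c] \in <[x]>, commute x [~ x, c] & commute c [~ x, c]].
Proof.
move=> Nc Rx; have powc := rigid_norm_power Nc; have [Rc _] := setIP Nc.
have [] := comm_power_commute Rc Rx powc.
by split=> //; apply: comm_power_mem Rx powc.
Qed.

Lemma rigid_cent_norm : 'C_R(N) \subset N.
Proof.
rewrite subsetI subsetIl (subset_trans (subsetIr _ _)) //.
by rewrite (subset_trans (centS _) (cent_sub _)) // subsetI sHR normG.
Qed.

(** [~ x, c] commutes with x and c, so its order divides both of theirs. *)
Lemma rigid_coprime_commute (pi : nat_pred) c x :
  c \in N -> x \in R -> pi.-elt c -> pi^'.-elt x -> commute x c.
Proof.
move=> Nc Rx pc p'x; apply/commgP; rewrite -order_eq1.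
have [_ cxd ccd] := rigid_comm Nc Rx.
have dvdx : #[[~ x, c]] %| #[x].
  by rewrite order_dvdn -commXg // expg_order comm1g.
have dvdc : #[[~ x, c]] %| #[c].
  by rewrite order_dvdn -commgX // expg_order commg1.
rewrite -dvdn1 -(eqP (pnat_coprime pc p'x)).
by rewrite dvdn_gcd dvdx dvdc.
Qed.

(** The commutator d of x and y is at once a product of two pi-elements and of
    two pi'-elements, so it commutes with both parts of every element of N and
    lies in N.  As d.`_pi normalises <[x]>, the product x * d.`_pi is a
    pi-element; it commutes with d.`_pi^', which is therefore the pi'-part of
    the pi-element x ^ y. *)
Lemma rigid_comm_pi_elt (pi : nat_pred) x y :
  x \in R -> y \in R -> pi.-elt x -> pi^'.-elt y -> pi.-elt [~ x, y].
Proof.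
move=> Rx Ry px p'y; set d := [~ x, y].
have pi'c z c : z \in R -> pi.-elt z -> c \in N -> commute z c.`_pi^'.
  move=> Rz pz Nc; apply: (rigid_coprime_commute (pi := pi^')) => //.
  - by rewrite groupX.
  - exact: p_elt_constt.
  - by rewrite p_eltNK.
have pic z c : z \in R -> pi^'.-elt z -> c \in N -> commute z c.`_pi.
  move=> Rz pz Nc; apply: (rigid_coprime_commute (pi := pi)) => //.
  - by rewrite groupX.
  - exact: p_elt_constt.
have Rd : d \in R by rewrite groupR.
have Nd : d \in N.
  apply: (subsetP rigid_cent_norm); rewrite inE Rd; apply/centP=> c Nc.
  rewrite -(consttC pi c); apply: commuteM; apply/commute_sym.
    rewrite /d commgEr; apply: commuteM; apply/commute_sym; apply: pic => //.
      by rewrite groupJ ?groupV.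
    by rewrite p_eltJ p_eltV.
  rewrite /d commgEl; apply: commuteM; apply/commute_sym; apply: pi'c => //.
  - by rewrite groupV.
  - by rewrite p_eltV.
  - exact: groupJ.
  - by rewrite p_eltJ.
have pw : pi.-elt (x * d.`_pi).
  have : pi.-group (<[x]> <*> <[d.`_pi]>).
    rewrite norm_joinEr ?pgroupM.
      by apply/andP; split; last exact: p_elt_constt.
    rewrite cycle_subG inE; apply/subsetP=> _ /imsetP[_ /cycleP[i ->] ->].
    by rewrite conjXg groupX // (rigid_norm_power (c := d.`_pi)) // groupX.
  by move/mem_p_elt; apply; rewrite groupM ?mem_gen // inE cycle_id ?orbT.
have xy : x ^ y = x * d.`_pi * d.`_pi^' by rewrite -mulgA consttC mulKVg.
have : pi.-elt (x ^ y) by rewrite p_eltJ.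
have cw : commute (x * d.`_pi) d.`_pi^'.
  apply/commute_sym/commuteM; apply/commute_sym; first exact: pi'c.
  by apply: commuteX2.
rewrite xy => pxy; rewrite -(consttC pi d).
suff -> : d.`_pi^' = 1 by rewrite mulg1 p_elt_constt.
have /constt1P : pi^'^'.-elt (x * d.`_pi * d.`_pi^') by rewrite p_eltNK.
rewrite consttM //.
have -> : (x * d.`_pi).`_pi^' = 1 by apply/constt1P; rewrite p_eltNK.
by rewrite mul1g constt_p_elt // p_elt_constt.
Qed.

Lemma rigid_pi_elt_commute (pi : nat_pred) x y :
  x \in R -> y \in R -> pi.-elt x -> pi^'.-elt y -> commute x y.
Proof.
move=> Rx Ry px p'y; apply/commgP; rewrite -order_eq1.
have pd := rigid_comm_pi_elt Rx Ry px p'y.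
have p'd : pi^'.-elt [~ x, y].
  rewrite -invg_comm p_eltV rigid_comm_pi_elt // p_eltNK //.
by rewrite (pnat_1 pd p'd).
Qed.

(** A Sylow p-subgroup is centralised by all Sylow subgroups for other primes,
    so the order of its normaliser is divisible by that of R. *)
Lemma rigid_nilpotent : nilpotent R.
Proof.
suff dvdF : #|R| %| #|'F(R)|.
  suff /eqP defF : 'F(R) == R :> {set gT} by rewrite -defF Fitting_nil.
  by rewrite eqEcard Fitting_sub dvdn_leq.
apply/(dvdn_partP _ (cardG_gt0 R)) => p _.
have [P sylP] := Sylow_exists p R; have [sPR pP _] := and3P sylP.
rewrite -(card_Hall sylP) cardSg // Fitting_max ?(pgroup_nil pP) //.
suff dvdN : #|R| %| #|'N_R(P)|.
  suff /eqP defN : 'N_R(P) == R :> {set gT} by rewrite -defN normalSG.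
  by rewrite eqEcard subsetIl dvdn_leq.
apply/(dvdn_partP _ (cardG_gt0 R)) => q _.
have [-> | neq_qp] := eqVneq q p.
  by rewrite -(card_Hall sylP) cardSg // subsetI sPR normG.
have [Q sylQ] := Sylow_exists q R; have [sQR qQ _] := and3P sylQ.
rewrite -(card_Hall sylQ) cardSg // subsetI sQR.
rewrite (subset_trans _ (cent_sub P)) //.
apply/subsetP=> y Qy; apply/centP=> x Px; apply: commute_sym.
have p'y : p^'.-elt y.
  by apply: sub_p_elt (mem_p_elt qQ Qy) => r /eqnP->; rewrite !inE.
by apply: rigid_pi_elt_commute (mem_p_elt pP Px) p'y;
  [apply: (subsetP sPR) | apply: (subsetP sQR)].
Qed.

(** An automorphism of 'O_pi(R) extends to R by the identity on 'O_pi^'(R). *)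
Lemma rigid_pcore (pi : nat_pred) :
  rigid 'O_pi(R)%G (H :&: 'O_pi(R))%G.
Proof.
move=> f injf fP fHP x Px; set P := 'O_pi(R)%G in f injf fP fHP Px *.
set K := 'O_pi^'(R)%G.
have defR : P \x K = R := nilpotent_pcoreC pi rigid_nilpotent.
have [_ defPK cKP tiPK] := dprodP defR.
have cKfP : idm K @* K \subset 'C(f @* P) by rewrite im_idm fP.
have sPR : P \subset R := pcore_sub _ _.
pose F := dprodm_morphism defR cKfP.
have injF : 'injm F.
  by rewrite injm_dprodm injf injm_idm im_idm fP tiPK eqxx.
have imF : F @* R = R by rewrite im_dprodm im_idm fP.
rewrite -(dprodmEl defR cKfP Px).
apply: (rigH injF) => //; last exact: (subsetP sPR).
apply/eqP; rewrite eqEcard card_injm // leqnn andbT.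
apply/subsetP=> _ /morphimP[h Rh Hh ->] /=.
have mem_pcore rho : h.`_rho \in 'O_rho(R).
  have hallR := nilpotent_pcore_Hall rho rigid_nilpotent.
  by rewrite (mem_normal_Hall hallR (pcore_normal _ _)) ?p_elt_constt ?groupX.
have Ph : h.`_pi \in P := mem_pcore pi.
have Kh : h.`_pi^' \in K := mem_pcore _.
rewrite -(consttC pi h) dprodmE // groupM //=; last by rewrite groupX.
have : f h.`_pi \in f @* (H :&: P) by rewrite mem_morphim // inE groupX.
by rewrite fHP => /setIP[].
Qed.

End Rigid.

Lemma rigid_transvection (gT : finGroupType) (R H B : {group gT}) p a t :
  rigid R H -> H \subset B -> B <| R -> #|R : B| = p -> prime p ->
  a \in R -> a \notin B -> t \in 'Z(B) -> (a * t) ^+ p = a ^+ p ->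
  t \in <[a]>.
Proof.
move=> rigH sHB nBR iB p_pr Ra nBa Zt atp.
have [f [injf imf fB fa]] := transvection_morphism nBR iB p_pr Ra nBa Zt atp.
have sHR := subset_trans sHB (normal_sub nBR).
have fH : f @* H = H.
  rewrite morphimEsub // -[RHS]imset_id; apply: eq_in_imset => h Hh.
  by rewrite fB // (subsetP sHB).
by have := rigH f injf imf fH a Ra; rewrite fa groupMl ?cycle_id.
Qed.

(** * Two facts on elements of finite groups *)

Lemma cycle_eq_order (gT : finGroupType) (x y z : gT) :
  y \in <[x]> -> z \in <[x]> -> #[y] = #[z] -> <[y]> = <[z]>.
Proof.
move=> xy xz oyz; apply/eqP; rewrite (eq_subG_cyclic (cycle_cyclic x)).
- by rewrite -!orderE oyz.
- by rewrite cycle_subG.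
by rewrite cycle_subG.
Qed.

Lemma noncentral_commg (gT : finGroupType) (R : {group gT}) t :
  t \in R -> t \notin 'Z(R) -> exists2 a, a \in R & [~ a, t] != 1.
Proof.
move=> Rt nZt; apply/exists_inP; apply: contraR nZt => /exists_inPn cRt.
rewrite inE Rt; apply/centP=> a Ra; apply/commute_sym/commgP.
by have := cRt a Ra; rewrite negbK.
Qed.

(** * Rigid subgroups of p-groups *)

(* z will turn out to generate the unique subgroup of order p of the center. *)
Section PGroup.

Variables (gT : finGroupType) (R H M : {group gT}) (p : nat) (z : gT).
Hypotheses (p_pr : prime p) (pR : p.-group R).
Hypotheses (rigH : rigid R H) (maxM : maximal M R) (sHM : H \subset M).
Hypotheses (Zz : z \in 'Z(R)) (Mz : z \in M) (oz : #[z] = p).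

Local Notation N := 'N_R(H).

Let sMR : M \subset R. Proof. by have /maxgroupp/proper_sub := maxM. Qed.
Let sHR : H \subset R. Proof. exact: subset_trans sHM sMR. Qed.
Let sZN : 'Z(R) \subset N.
Proof.
rewrite subsetI center_sub (subset_trans (subsetIr _ _)) //.
by rewrite (subset_trans (centS sHR)) ?cent_sub.
Qed.
Let sHN : H \subset N. Proof. by rewrite subsetI sHR normG. Qed.

(** The transvection fixing M and sending x to x * w must be a power
    automorphism. *)
Lemma central_in_outer_cycle w x :
  w \in 'Z(R) -> w \in M -> w ^+ p = 1 -> x \in R -> x \notin M -> w \in <[x]>.
Proof.
move=> Zw Mw wp Rx nMx.
have cwR : w \in 'C(R) by case/setIP: Zw.
apply: (rigid_transvection (p := p) rigH sHM) => //.
- exact: p_maximal_normal pR maxM.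
- exact: p_maximal_index pR maxM.
- by rewrite inE Mw (subsetP (centS sMR)).
by rewrite expgMn ?wp ?mulg1 //; apply/commute_sym/(centP cwR).
Qed.

Lemma outer_cycle_pth_root x y :
  x \in R -> x \notin M -> y \in <[x]> -> y ^+ p = 1 -> y \in <[z]>.
Proof.
move=> Rx nMx xy yp1.
have xz : z \in <[x]>.
  by apply: central_in_outer_cycle; rewrite // -oz expg_order.
have /(proj2 (primeP p_pr))/orP[|/eqP oy] : #[y] %| p by rewrite order_dvdn yp1.
  by rewrite order_eq1 => /eqP->; rewrite group1.
by rewrite -(cycle_eq_order xy xz) ?cycle_id // oy oz.
Qed.

Let outer : exists2 x, x \in R & x \notin M.
Proof. by have /maxgroupp/properP[_ [x Rx nMx]] := maxM; exists x. Qed.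

Lemma center_pth_root y : y \in 'Z(R) -> y ^+ p = 1 -> y \in <[z]>.
Proof.
move=> Zy yp1; have Ry : y \in R by case/setIP: Zy.
case My: (y \in M); last first.
  by apply: outer_cycle_pth_root (cycle_id y) yp1; rewrite ?My.
have [x Rx nMx] := outer; apply: (outer_cycle_pth_root Rx nMx) => //.
exact: central_in_outer_cycle.
Qed.

(** For g outside M, [~ g, c] is an element of <[g]> whose p-th power is
    [~ g, c ^+ p] = 1; and R is generated by the elements outside M. *)
Lemma comm_in_z c g :
  c \in N -> c ^+ p \in 'Z(R) -> g \in R -> [~ g, c] \in <[z]>.
Proof.
move=> Nc Zcp Rg.
have outc x : x \in R -> x \notin M -> [~ x, c] \in <[z]>.
  move=> Rx nMx; have [xd _ cd] := rigid_comm rigH sHR Nc Rx.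
  apply: (outer_cycle_pth_root Rx nMx) => //; rewrite -commgX //.
  by apply/eqP/commgP/commute_sym; case/setIP: Zcp => _ /centP; apply.
case Mg: (g \in M); last by apply: outc; rewrite ?Mg.
have [x Rx nMx] := outer; rewrite -(mulgKV x g) commMgJ groupM ?outc //.
have nzx : x \in 'N(<[z]>).
  have nzR : <[z]> <| R by apply: sub_center_normal; rewrite cycle_subG.
  exact: (subsetP (normal_norm nzR)).
rewrite memJ_norm //; apply: outc; first by rewrite groupM ?groupV.
by rewrite groupMl // groupV.
Qed.

Section Cent.

Variable t : gT.
Hypotheses (Nt : t \in N) (Ztp : t ^+ p \in 'Z(R)) (nZt : t \notin 'Z(R)).

Let Rt : t \in R. Proof. by case/setIP: Nt. Qed.

(** The class of t lies in the coset t *: <[z]>. *)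
Lemma index_cent_root : #|R : 'C_R[t]| = p.
Proof.
have p_i : p.-nat #|R : 'C_R[t]| by exact: pnat_dvd (dvdn_indexg _ _) pR.
have le_ip : #|R : 'C_R[t]| <= p.
  rewrite index_cent1 -oz orderE -(card_lcoset <[z]> t) subset_leq_card //.
  apply/subsetP=> _ /imsetP[g Rg ->].
  by rewrite mem_lcoset -commgEl -invg_comm groupV comm_in_z.
have ne1 : #|R : 'C_R[t]| != 1%N.
  apply: contra nZt => /eqP/index1g; rewrite subsetIl => /(_ isT) eqR.
  rewrite inE Rt; apply/centP=> g; rewrite -{1}eqR => /setIP[_ /cent1P//].
have [k def_i] := p_natP p_i; move: le_ip ne1; rewrite def_i.
case: k {def_i} => [|[|k]] //.
by rewrite leqNgt -{1}[p]expn1 ltn_exp2l // prime_gt1.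
Qed.

(** Otherwise the transvection fixing 'C_R[t] and sending a to a * t fixes H,
    so that t is a power of a and commutes with a. *)
Lemma transvection_by_root_contra a :
  H \subset 'C[t] -> a \in R -> [~ a, t] != 1 ->
  (a * t) ^+ p = a ^+ p -> False.
Proof.
move=> cHt Ra nc_at atp.
have maxC : maximal 'C_R[t] R.
  by apply: p_index_maximal; rewrite ?subsetIl ?index_cent_root.
suff /cycleP[i def_t] : t \in <[a]>.
  by case/negP: nc_at; apply/commgP; rewrite def_t; apply: commuteX.
apply: (rigid_transvection rigH _ _ index_cent_root p_pr Ra _ _ atp).
- by rewrite subsetI sHR.
- exact: p_maximal_normal pR maxC.
- apply: contra nc_at => /setIP[_ /cent1P c_at].
  by apply/commgP; rewrite /commute c_at.
rewrite inE inE Rt cent1id; apply/centP=> x /setIP[_ /cent1P]; exact.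
Qed.

End Cent.

(** Here (a * t) ^+ p = a ^+ p * t ^+ p * [~ t, a] ^+ 'C(p, 2) for every a.  If
    p is odd, the last factor is 1 since p divides 'C(p, 2); if p = 2 it is z
    when a and t do not commute, and z cancels t ^+ 2. *)
Lemma noncentral_root_contra t : t \in N -> H \subset 'C[t] -> t \notin 'Z(R) ->
  odd p && (t ^+ p == 1) || (p == 2) && (t ^+ 2 == z) -> False.
Proof.
move=> Nt cHt nZt tp; have [Rt _] := setIP Nt.
have Ztp : t ^+ p \in 'Z(R).
  case/orP: tp => /andP[]; first by move=> _ /eqP->; rewrite group1.
  by move/eqP=> -> /eqP->.
have [a Ra nc_at] := noncentral_commg Rt nZt.
apply: (transvection_by_root_contra Nt Ztp nZt cHt Ra nc_at).
have zd : [~ t, a] \in <[z]> by rewrite -invg_comm groupV comm_in_z.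
have cd x : x \in R -> commute x [~ t, a].
  move=> Rx; apply/commute_sym.
  have /setIP[_ /centP] : [~ t, a] \in 'Z(R); last exact.
  by apply: subsetP zd; rewrite cycle_subG.
rewrite (expMg_Rmul _ (cd t Rt) (cd a Ra)).
case/orP: tp => /andP[].
  move=> odd_p /eqP->; rewrite mulg1.
  have /dvdnP[k ->] : p %| 'C(p, 2).
    by rewrite prime_dvd_bin // odd_prime_gt2.
  case/cycleP: zd => j ->; rewrite mulnC expgM (expgAC z j) -oz expg_order.
  by rewrite !expg1n mulg1.
move=> /eqP p2 /eqP tz; rewrite p2 tz -mulgA.
have zz : z * z = 1 by rewrite -(expg_order z) oz p2.
suff -> : [~ t, a] = z by rewrite binn expg1 zz mulg1.
move: zd; rewrite cycle2g ?oz // !inE => /orP[/eqP d1|/eqP//].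
by case/negP: nc_at; rewrite -invg_comm d1 invg1.
Qed.

(** For c in N, [~ n, c] lies in <[n]> because c normalises it, and in <[z]> by
    [comm_in_z]; these are distinct subgroups of order p. *)
Lemma noncentral_root_cent n :
  n \in N -> n ^+ p = 1 -> n \notin 'Z(R) -> n \in 'C(N).
Proof.
move=> Nn np1 nZn; apply/centP=> c Nc; apply/commgP.
have [[Rn _] [Rc _]] := (setIP Nn, setIP Nc).
have on : #[n] = p.
  by apply: nt_prime_order => //; apply: contraNneq nZn => ->; rewrite group1.
have tinz : <[n]> :&: <[z]> = 1.
  apply: prime_TIg; first by rewrite -orderE on.
  apply: contra nZn => /subset_trans snz.
  by rewrite -cycle_subG snz // cycle_subG.
rewrite -in_set1 -[[set 1]]tinz inE; have [-> _ _] := rigid_comm rigH sHR Nc Rn.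
by rewrite -invg_comm groupV comm_in_z // np1 group1.
Qed.

Lemma order2_cycle_eq w : p = 2 -> w \in <[z]> -> w != 1 -> w = z.
Proof.
by move=> p2; rewrite cycle2g ?oz // !inE => /orP[->|/eqP->].
Qed.

Lemma order2_noncommuting n a :
  p = 2 -> n \in N -> n ^+ 2 = 1 -> n \notin 'Z(R) -> a \in R ->
  [~ a, n] != 1 -> [/\ [~ a, n] = z, z \in <[a]> & a ^+ 2 != 1].
Proof.
move=> p2 Nn n2 nZn Ra ncan.
have an_z : [~ a, n] = z.
  apply: (order2_cycle_eq p2) => //.
  by apply: comm_in_z => //; rewrite p2 n2 group1.
have za : z \in <[a]> by rewrite -an_z; have [] := rigid_comm rigH sHR Nn Ra.
split=> //; apply/eqP => a2; case/negP: ncan; rewrite an_z.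
have : z \in [set 1; a].
  case/cycleP: za => i ->.
  rewrite (divn_eq i 2) expgD mulnC expgM a2 expg1n mul1g modn2.
  by case: (odd i); rewrite !inE ?eqxx ?orbT.
rewrite !inE => /orP[//|/eqP eza]; rewrite -an_z; apply/commgP.
by rewrite -eza; case/setIP: Zz => _ /centP; apply; case/setIP: Nn.
Qed.

(** Let a be an element not commuting with n.  Then z is a power of a, and a has
    order at least 8: an element of order 2 not commuting with n would be z,
    and if a ^+ 2 = z then a * n is such an element.  So <[a]> contains some v
    of order 8, and u = v ^+ 2 works: for m in N, [~ v, m] is a power of v that
    commutes with v and m, so either u is a power of [~ v, m], or [~ v, m] has
    order at most 2 and [~ u, m] = [~ v, m] ^+ 2 = 1.  Finally u lies in N
    since 'C_R(N) does. *)
Lemma order4_central n : p = 2 -> n \in N -> n ^+ 2 = 1 -> n \notin 'Z(R) ->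
  exists u, [/\ u \in N, u \in 'C(N) & u ^+ 2 = z].
Proof.
move=> p2 Nn n2 nZn; have [Rn _] := setIP Nn.
have [a Ra ncan] := noncentral_commg Rn nZn.
have [an_z za a2] := order2_noncommuting p2 Nn n2 nZn Ra ncan.
have [_ cRz] := setIP Zz.
have zz : z * z = 1 by rewrite -(expg_order z) oz p2.
have a2z : a ^+ 2 != z.
  apply/eqP => a2z.
  have ncann : [~ a * n, n] != 1.
    have -> : [~ a * n, n] = [~ a, n] ^ n.
      by rewrite commMgJ [X in _ * X](_ : _ = 1) ?mulg1 //; apply/eqP/commgP.
    by rewrite conjg_eq1.
  have [_ _ /eqP[]] := order2_noncommuting p2 Nn n2 nZn (groupM Ra Rn) ncann.
  have na_z : [~ n, a] = z.
    by rewrite -invg_comm an_z; apply/eqP; rewrite eq_invg_mul zz.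
  rewrite expMg_Rmul ?na_z; try by apply/commute_sym/(centP cRz).
  by rewrite n2 mulg1 a2z binn expg1.
have pa : 2.-nat #[a] by rewrite -p2; exact: mem_p_elt pR Ra.
have [k oa] := p_natP pa.
have z_uniq b : b \in <[a]> -> #[b] = 2 -> z \in <[b]>.
  by move=> ab ob; rewrite (cycle_eq_order ab za) ?cycle_id // ob oz p2.
have k_gt2 : 2 < k.
  rewrite ltnNge; apply/negP=> le_k2.
  have a4 : (a ^+ 2) ^+ 2 = 1.
    by rewrite -expgM; apply/eqP; rewrite -order_dvdn oa (@dvdn_exp2l 2 k 2).
  have oa2 : #[a ^+ 2] = 2 by apply: nt_prime_order.
  have := z_uniq _ (mem_cycle a 2) oa2.
  rewrite cycle2g // !inE => /orP[|/eqP eza2]; last by case/eqP: a2z.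
  by rewrite -order_eq1 oz p2.
have [v av ov] : exists2 v, v \in <[a]> & #[v] = 8.
  exists (a ^+ (2 ^ (k - 3))); first exact: mem_cycle.
  rewrite orderXdiv oa; last by rewrite dvdn_exp2l ?leq_subr.
  by rewrite -expnB ?leq_subr // subKn.
have Rv : v \in R by apply: subsetP av; rewrite cycle_subG.
have v8 : v ^+ 8 = 1 by rewrite -ov expg_order.
have v4 : (v ^+ 2) ^+ 2 = z.
  have ov4 : #[(v ^+ 2) ^+ 2] = 2 by rewrite -expgM orderXdiv ov.
  have: z \in <[(v ^+ 2) ^+ 2]> by rewrite z_uniq ?groupX ?cycle_id.
  rewrite cycle2g // !inE => /orP[|/eqP-> //].
  by rewrite -order_eq1 oz p2.
have cNu : v ^+ 2 \in 'C(N).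
  apply/centP=> m Nm; apply/commgP.
  have [/cyclePmin[i]] := rigid_comm rigH sHR Nm Rv.
  rewrite ov => lti8 vm cv cm.
  rewrite commXg // vm -expgM mulnC expgM.
  have use j : i * j = 2 %[mod 8] -> (v ^+ 2) ^+ i == 1.
    move=> ij; have v2 : v ^+ 2 = [~ v, m] ^+ j.
      by rewrite vm -expgM -(expg_mod (i * j) v8) ij (expg_mod 2 v8).
    rewrite -expgM mulnC expgM -vm -commXg // v2; apply/commgP/commute_sym.
    exact: commuteX.
  (* Modulo 8, a solution j of i * j = 2 is 2 * i for odd i and i / 2 for
     i = 2, 6; there is none if 4 divides i. *)
  case: i lti8 {vm} use => [|[|[|[|[|[|[|[|//]]]]]]]] _ use.
  - by rewrite expg0.
  - exact: (use 2).
  - exact: (use 1%N).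
  - exact: (use 6).
  - by rewrite -expgM v8.
  - exact: (use 2).
  - exact: (use 3).
  - exact: (use 6).
exists (v ^+ 2); split=> //.
by apply: (subsetP (rigid_cent_norm sHR)); rewrite inE groupX.
Qed.

(** If p is odd, n itself gives a forbidden transvection.  If p = 2, use the u
    above when it is not central, and n * u otherwise: n * u is not central and
    its square is z. *)
Lemma norm_roots_central n : n \in N -> n ^+ p = 1 -> n \in 'Z(R).
Proof.
move=> Nn np1; apply/negPn/negP=> nZn.
have cNn := noncentral_root_cent Nn np1 nZn.
have cH w : w \in 'C(N) -> H \subset 'C[w].
  by move=> cNw; rewrite sub_cent1 (subsetP (centS sHN)).
have [p2 | odd_p] := even_prime p_pr; last first.
  by apply: (noncentral_root_contra Nn (cH n cNn) nZn); rewrite odd_p np1 eqxx.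
rewrite p2 in np1; have [u [Nu cNu u2]] := order4_central p2 Nn np1 nZn.
case Zu: (u \in 'Z(R)); last first.
  apply: (noncentral_root_contra Nu (cH u cNu)); rewrite ?Zu //.
  by rewrite u2 p2 !eqxx orbT.
have nZnu : n * u \notin 'Z(R) by rewrite groupMr.
apply: (noncentral_root_contra _ (cH _ _) nZnu); rewrite ?groupM //.
by rewrite p2 expgMn ?np1 ?mul1g ?u2 ?eqxx ?orbT //; apply: (centP cNn).
Qed.

(** If H is nontrivial its elements of order p are central, hence in <[z]>, so H
    contains <[z]>; and [comm_in_z] bounds the commutators of H by <[z]>. *)
Lemma norm_full_of_powers :
  (forall h, h \in H -> h ^+ p \in 'Z(R)) -> N = R.
Proof.
move=> ZHp; apply/setIidPl.
have [-> | ntH] := eqVneq (gval H) 1; first exact: norms1.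
have [_ p_dvd _] := pgroup_pdiv (pgroupS sHR pR) ntH.
have [h Hh oh] := Cauchy p_pr p_dvd.
have sZH : <[z]> \subset H.
  have zh : h \in <[z]>.
    have hp : h ^+ p = 1 by rewrite -oh expg_order.
    by rewrite center_pth_root ?norm_roots_central ?(subsetP sHN).
  by rewrite -(cycle_eq_order zh (cycle_id z)) ?cycle_subG // oh oz.
apply/subsetP=> g Rg; rewrite inE; apply/subsetP=> _ /imsetP[x Hx ->].
rewrite -(mulKVg x (x ^ g)) -commgEl groupM // (subsetP sZH) //.
by rewrite -invg_comm groupV comm_in_z ?ZHp ?(subsetP sHN).
Qed.

(** N is cyclic or quaternion.  In the quaternion case, take generators x and y
    with x ^ y = x^-1: [~ x, y] = x ^- 2 commutes with y, so x ^+ 4 = 1.  This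
    makes N of order 8 and equal to R, so that M is abelian of order 4, and any
    t in M outside 'Z(R) gives a forbidden transvection. *)
Lemma rigid_pgroup_cyclic : cyclic R.
Proof.
have ntN : N != 1.
  apply/trivgPn; exists z; first exact: subsetP Zz.
  by rewrite -order_eq1 oz neq_ltn prime_gt1 ?orbT.
have pN : p.-group N := pgroupS (subsetIl _ _) pR.
have oN1 : #|'Ohm_1(N)| = p.
  rewrite -[RHS]oz orderE (OhmE 1 pN) expn1; congr #|(_ : {set _})|; apply/eqP.
  rewrite eqEsubset gen_subG cycle_subG mem_gen; last first.
    by apply/LdivP; rewrite (subsetP sZN) // -oz expg_order.
  rewrite andbT; apply/subsetP=> n /LdivP[Nn n1].
  by rewrite center_pth_root ?norm_roots_central.
have /(prime_Ohm1P pN ntN)/orP[cycN|] := oN1.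
  suff <- : N = R by [].
  apply/setIidPl; have := rigid_norm_normal rigH sHR.
  have cHN : H \char N by rewrite sub_cyclic_char.
  by case/(char_normal_trans cHN)/andP.
case/andP=> /eqP p2 /eqP/quaternion_classP[n n_gt2 isoN].
have [[x y] genxy [_ _ xy]] := generators_quaternion n_gt2 isoN.
have [oN Nx ox /setDP[Ny _]] := genxy.
have [[_ order4 _] _ [_ oZN _ _ _] _ _] :=
  quaternion_structure n_gt2 genxy isoN.
have Rx : x \in R by case/setIP: Nx.
have x4 : x ^+ 4 = 1.
  have [_ _] := rigid_comm rigH sHR Ny Rx.
  have -> : [~ x, y] = x ^- 2 by rewrite commgEl xy expgSr expg1 invMg.
  move=> cy; have : (x ^- 2) ^ y = x ^- 2 by rewrite conjgE -cy mulKg.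
  rewrite conjVg conjXg xy expVgn invgK (expgD x 2 2) => {1}->.
  by rewrite mulVg.
have exp4 h : h \in N -> (h ^+ 2) ^+ 2 = 1.
  move=> Nh; rewrite -expgM -[(2 * 2)%N]/4.
  have [/cycleP[i ->] | Xh] := boolP (h \in <[x]>).
    by rewrite expgAC x4 expg1n.
  by rewrite -(order4 h) ?expg_order // inE Xh.
have sq_central h : h \in N -> h ^+ 2 \in 'Z(R).
  by move=> Nh; rewrite norm_roots_central ?groupX // p2 exp4.
have defN : N = R.
  apply: norm_full_of_powers => h Hh.
  by rewrite p2 sq_central ?(subsetP sHN).
have n3 : n = 3.
  have : 2 ^ n.-1 %| 2 ^ 2 by rewrite -ox order_dvdn x4.
  rewrite dvdn_Pexp2l // -ltnS prednK ?(ltn_trans _ n_gt2) // => le_n3.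
  by apply/eqP; rewrite eqn_leq n_gt2 le_n3.
have oM : #|M| = (2 ^ 2)%N.
  have := Lagrange sMR; rewrite (p_maximal_index pR maxM) p2 -defN oN n3.
  by rewrite (expnSr 2 2) => /eqP; rewrite eqn_pmul2r // => /eqP.
have cMM : abelian M by apply: card_p2group_abelian oM.
have [t Mt nZt] : exists2 t, t \in M & t \notin 'Z(R).
  apply/subsetPn; apply/negP => /subset_leq_card.
  by rewrite oM -defN oZN.
have Nt : t \in N by rewrite defN (subsetP sMR).
apply: False_ind; apply: (noncentral_root_contra Nt _ nZt).
  by rewrite sub_cent1 (subsetP (centS sHM)) // (subsetP cMM).
rewrite p2 /=; apply/eqP/(order2_cycle_eq p2).
  by rewrite center_pth_root ?sq_central // p2 exp4.
by apply: contra nZt => /eqP t2; rewrite norm_roots_central ?p2.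
Qed.

End PGroup.

(** H = R may be replaced by H = 1, which has the same stabiliser. *)
Lemma rigid_pgroup (gT : finGroupType) (R H : {group gT}) (p : nat) :
  p.-group R -> H \subset R -> rigid R H -> cyclic R.
Proof.
wlog prH : H / H \proper R => [wlogH|] pR sHR rigH.
  have [sRH | nsRH] := boolP (R \subset H); last first.
    by apply: (wlogH H); rewrite // properE sHR.
  have [-> | ntR] := eqVneq (gval R) 1; first exact: cyclic1.
  apply: (wlogH 1%G); rewrite ?sub1G // ?proper1G // => f injf fR _.
  have defH : H :=: R by apply/eqP; rewrite eqEsubset sHR.
  by apply: (rigH f injf fR); rewrite defH.
have ntR : R :!=: 1.
  by apply: contraTneq prH => ->; rewrite properE sub1G andbF.
have [p_pr _ _] := pgroup_pdiv pR ntR.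
have [M maxM sHM] :=
  maxgroup_exists (prH : (fun K : {group gT} => K \proper R) H).
have iM := p_maximal_index pR maxM.
have [M1 | ntM] := eqVneq (gval M) 1.
  by apply: prime_cyclic; rewrite -indexg1 -M1 iM.
have ntMZ := meet_center_nil (pgroup_nil pR) (p_maximal_normal pR maxM) ntM.
have pMZ : p.-group (M :&: 'Z(R)).
  by apply: pgroupS pR; rewrite subIset // center_sub orbT.
have [_ p_dvd _] := pgroup_pdiv pMZ ntMZ.
have [z /setIP[Mz Zz] oz] := Cauchy p_pr p_dvd.
exact: rigid_pgroup_cyclic p_pr pR rigH maxM sHM Zz Mz oz.
Qed.

Lemma rigid_cyclic (gT : finGroupType) (R H : {group gT}) :
  H \subset R -> rigid R H -> cyclic R.
Proof.
move=> sHR rigH; have nilR := rigid_nilpotent rigH sHR.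
apply: nil_Zgroup_cyclic => //; apply/forall_inP=> P /SylowP[p p_pr sylP].
rewrite (nilpotent_Hall_pcore nilR sylP).
apply: (rigid_pgroup (pcore_pgroup p R) (subsetIr H _)).
exact: rigid_pcore rigH sHR p.
Qed.

(** * The action on the set of subgroups *)

Section Bridge.

Variables (gT : finGroupType) (R : {group gT}).

Lemma val_subgroup_action (K : subgroup_of R) a :
  a \in Aut R -> val (subgroup_action R K a) = a @: val K.
Proof.
by move=> Aa; rewrite val_subact (subsetP (Aut_subact_dom R)).
Qed.

(** An automorphism stabilising K acts trivially on all subgroups; looking at
    its action on <[x]> shows that it sends x to a power of x. *)
Lemma base1_rigid (K : subgroup_of R) :
  'C_(A_group R)([set:: [:: K]] | 'P) = 1 ->
  exists2 H : {group gT}, H \subset R & rigid R H.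
Proof.
move=> C1; have /andP[gK sKR] := valP K.
exists (Group gK) => // f injf fR fK x Rx.
pose a := aut injf fR; have Aa : a \in Aut R := Aut_aut injf fR.
have aE (S : {set gT}) : S \subset R -> a @: S = f @* S.
  move=> sSR; rewrite morphimEsub //; apply: eq_in_imset => y Sy.
  by rewrite autE // (subsetP sSR).
have fixK : subgroup_action R K a = K.
  by apply: val_inj; rewrite val_subgroup_action // aE.
have Da := subsetP (Aut_subact_dom R) a Aa.
have : actperm (subgroup_action R) a \in 'C_(A_group R)([set:: [:: K]] | 'P).
  rewrite inE mem_morphim //; apply/astabP=> L; rewrite !inE => /eqP->.
  by rewrite /= apermE actpermE.
rewrite C1 => /set1P a1.
have sgX : is_subgroup R <[x]> by rewrite /is_subgroup groupP cycle_subG.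
pose X : subgroup_of R := exist _ <[x]> sgX.
have := congr1 (fun s : {perm subgroup_of R} => val (s X)) a1.
rewrite perm1 actpermE val_subgroup_action //= => aX.
by rewrite -aX aE ?cycle_subG // mem_morphim // cycle_id.
Qed.

Lemma cyclic_A_group : cyclic R -> A_group R :=: 1.
Proof.
move=> cycR; apply/trivgP/subsetP=> _ /morphimP[a Da Aa ->].
apply/set1P/permP=> K.
apply: val_inj; rewrite perm1 actpermE val_subgroup_action //.
have /andP[gK sKR] := valP K.
have : Group gK \char R by rewrite sub_cyclic_char.
case/charP=> _ /(_ (autm_morphism Aa) (injm_autm Aa) (im_autm Aa)).
by rewrite morphimEsub.
Qed.

End Bridge.

Theorem theorem1p1 (gT : finGroupType) (R : {group gT}) :
  base_size (trivial_subgroup R) (A_group R) = 1%N <-> cyclic R.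
Proof.
rewrite /base_size; case: ex_minnP => m base_m min_m; split=> [m1 | cycR].
  move: base_m; rewrite m1 => /existsP[s /andP[_ /eqP C1]].
  case: s C1 => [[|K []] //= _] C1.
  by have [H sHR rigH] := base1_rigid C1; apply: rigid_cyclic sHR rigH.
have base1 : has_base_of_size (A_group R) 1.
  apply/existsP; exists [tuple trivial_subgroup R].
  by rewrite /is_base /= cyclic_A_group // -subG1 subsetIl.
have := min_m _ base1; case: m base_m {min_m} => [/existsP[s]|[]//].
by rewrite tuple0.
Qed.
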